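(* Let $A=(a_{ij})$ be an $n\times n$ complex matrix, let $A_0=\mathrm{diag}(a_{11},\dots,a_{nn})$, and let $A(t)=A_0+t(A-A_0)$ for $t\in[0,1]$. Then each continuous eigenvalue curve of $A(t)$ lies entirely in a connected Geršgorin region of $A$. That is, for every continuous function $\lambda:[0,1]\to\mathbb{C}$ such that $\lambda(t)$ is an eigenvalue of $A(t)$ for every $t\in[0,1]$, there is a connected Geršgorin region $R$ of $A$ with $\lambda([0,1])\subseteq R$.
   Context: For an $n\times n$ complex matrix $A=(a_{ij})$, the Geršgorin disks of $A$ are the closed disks $D_i=\{z\in\mathbb{C}: |z-a_{ii}|\le \sum_{j\neq i}|a_{ij}|\}$, $i=1,\dots,n$ (radius $0$ is allowed). A Geršgorin region of $A$ is a union of some of the Geršgorin disks of $A$; it need not be connected in general, and it is called a connected Geršgorin region if it is a connected subset of $\mathbb{C}$. A curve is the image of a continuous map from a real closed interval to $\mathbb{C}$. A continuous eigenvalue curve of $A(t)$, $t\in[0,1]$, is the image $\lambda([0,1])$ of a continuous function $\lambda:[0,1]\to\mathbb{C}$ such that $\lambda(t)$ is an eigenvalue of $A(t)$ for every $t\in[0,1]$. *)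

(* Defs.v *)
From HB Require Import structures.
From mathcomp Require Import all_boot all_order all_algebra.
From mathcomp Require Import all_classical all_reals all_analysis.
From mathcomp Require Import complex.

Set Implicit Arguments.
Unset Strict Implicit.
Unset Printing Implicit Defensive.

Import Order.TTheory GRing.Theory Num.Theory.
Import numFieldNormedType.Exports.

Local Open Scope classical_set_scope.
Local Open Scope ring_scope.
Local Open Scope complex_scope.

(* The norm of R[i] takes its values in R[i], where x <= y means that y - x is
   a nonnegative real, so the bound below is an inequality between reals.
   R[i] itself carries no topology; its regular module R[i]^o carries the one
   induced by the norm, hence subsets of the plane are typed as set R[i]^o. *)
Definition gersgorin_disk (R : realType) (n : nat) (A : 'M[R[i]]_n)
    (k : 'I_n) : set R[i]^o :=
  [set z : R[i]^o | `|(z : R[i]) - A k k| <= \sum_(j < n | j != k) `|A k j|].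

Definition gersgorin_region (R : realType) (n : nat) (A : 'M[R[i]]_n)
    (D : set R[i]^o) : Prop :=
  exists S : set 'I_n, D = \bigcup_(k in S) gersgorin_disk A k.

Definition diag_part (R : realType) (n : nat) (A : 'M[R[i]]_n) : 'M[R[i]]_n :=
  diag_mx (\row_k A k k).

Definition gersgorin_homotopy (R : realType) (n : nat) (A : 'M[R[i]]_n)
    (t : R) : 'M[R[i]]_n :=
  diag_part A + t%:C *: (A - diag_part A).

(* Only the restriction of lambda to [0, 1] matters: continuity is for the
   subspace topology of [0, 1]. *)
Definition continuous_eigenvalue_function (R : realType) (n : nat)
    (At : R -> 'M[R[i]]_n) (lambda : R -> R[i]^o) : Prop :=
  {within `[0, 1]%classic, continuous lambda} /\
  forall t : R, 0 <= t <= 1 -> eigenvalue (At t) (lambda t).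

(* Main.v *)
Require Import Defs.
From HB Require Import structures.
From mathcomp Require Import all_boot all_order all_algebra.
From mathcomp Require Import all_classical all_reals all_analysis.
From mathcomp Require Import complex.
Set Implicit Arguments.
Unset Strict Implicit.
Unset Printing Implicit Defensive.
Import Order.TTheory GRing.Theory Num.Theory.
Import numFieldNormedType.Exports.
Local Open Scope classical_set_scope.
Local Open Scope ring_scope.
Local Open Scope complex_scope.

(** Let D be the union of those disks of A that meet the curve lambda([0, 1]).

    The curve lies in D: by the disk theorem ([eigenvalue_in_gersgorin_disk])
    each point lambda t is in some disk of A(t), and for t in [0, 1] the disks
    of A(t) are the disks of A shrunk about the same centers
    ([gersgorin_disk_homotopy_sub]), so lambda t is in a disk of A, which is
    then one of the chosen disks.

    D is connected: the curve is connected as the continuous image of [0, 1],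
    each disk is connected ([gersgorin_disk_connected]), and each chosen disk
    meets the curve. So D is a union of connected sets, disk together with
    curve, which all contain the point lambda 0. *)

(** The classical argument: compare the entry of largest modulus of an
    eigenvector with the others. The disks are given by row sums, so the
    eigenvector has to be a column vector, whereas [eigenvalue] speaks of row
    vectors; hence the passage to the transpose. *)
Lemma eigenvalue_in_gersgorin_disk (F : numFieldType) (n : nat) (M : 'M[F]_n)
    (a : F) :
  eigenvalue M a ->
  exists k, `|a - M k k| <= \sum_(j < n | j != k) `|M k j|.
Proof.
move=> eva; have: eigenvalue M^T a.
  move: eva; rewrite /eigenvalue /eigenspace !kermx_eq0 !row_free_unit.
  by rewrite -[in X in _ -> X]unitmx_tr linearB /= trmxK tr_scalar_mx.
case/eigenvalueP=> v vM /rV0Pn[i0 vi0].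
have [|k _ kmax] := @real_arg_maxP _ _ i0 predT (fun i => `|v 0 i|) isT.
  by move=> i _; exact: normr_real.
have vk : 0 < `|v 0 k| by apply: lt_le_trans (kmax i0 isT); rewrite normr_gt0.
exists k; rewrite -(ler_pM2l vk) -normrM mulr_sumr.
have /rowP/(_ k) := vM; rewrite !mxE (bigD1 k) //= !mxE => eqk.
have -> : v 0 k * (a - M k k) = \sum_(j < n | j != k) v 0 j * M k j.
  rewrite mulrBr [v 0 k * a]mulrC -eqk addrAC subrr add0r.
  by apply: eq_bigr => j _; rewrite mxE.
apply: le_trans (ler_norm_sum _ _ _) _; apply: ler_sum => j _.
by rewrite normrM; apply: ler_wpM2r; [exact: normr_ge0 | exact: kmax].
Qed.

(** A(t) has the diagonal of A, and its off-diagonal entries are those of A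
    multiplied by t: centers are kept and radii are multiplied by t. *)
Lemma gersgorin_disk_homotopy_sub (R : realType) (n : nat) (A : 'M[R[i]]_n)
    (t : R) (k : 'I_n) :
  0 <= t <= 1 ->
  gersgorin_disk (gersgorin_homotopy A t) k `<=` gersgorin_disk A k.
Proof.
case/andP=> t0 t1 z.
rewrite /gersgorin_disk /= !mxE eqxx mulr1n subrr mulr0 addr0.
move=> /le_trans; apply; apply: ler_sum => j jk.
rewrite !mxE eq_sym (negPf jk) mulr0n add0r subr0 normrM.
by rewrite ler_piMl// ger0_norm ?lecR// (lecR 1).
Qed.

Lemma real_complex_continuous (R : realType) :
  continuous (fun t : R => t%:C : R[i]^o).
Proof.
move=> t; apply/cvgrPdist_lt => e e0.
(* The radius e is a positive element of R[i], hence a real number. *)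
have [r r0 ->] : exists2 r : R, 0 < r & e = r%:C.
  by case: e e0 => r s; rewrite ltcE /= => /andP[/eqP -> ?]; exists r.
near=> s.
rewrite -rmorphB /= normc_def /= expr0n /= addr0 sqrtr_sqr ltcR.
near: s; exact: cvgr_dist_lt.
Unshelve. all: by end_near. Qed.

(** A disk is star-shaped: it is the union of the segments from its center to
    its points. *)
Lemma gersgorin_disk_connected (R : realType) (n : nat) (A : 'M[R[i]]_n)
    (k : 'I_n) : connected (gersgorin_disk A k).
Proof.
set c : R[i]^o := A k k.
pose segment (z : R[i]^o) :=
  [set c + (t%:C : R[i]) *: (z - c) | t in `[0, 1]%classic].
have -> : gersgorin_disk A k = \bigcup_(z in gersgorin_disk A k) segment z.
  apply/seteqP; split=> [z Dz|_ [z Dz [t t01 <-]]].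
    exists z => //; exists 1; first by rewrite /= in_itv /= ler01 lexx.
    by rewrite scale1r addrC subrK.
  move: t01; rewrite /= in_itv /= => /andP[t0 t1].
  move: Dz; rewrite /gersgorin_disk /=.
  apply: le_trans; rewrite -/c addrC addKr normrM.
  by rewrite ler_piMl// ger0_norm ?lecR// (lecR 1).
apply: bigcup_connected.
  exists c => z _; exists 0; rewrite /= ?in_itv /= ?lexx ?ler01//.
  by rewrite scale0r addr0.
move=> z _; apply: connected_continuous_connected; first exact: segment_connected.
apply: continuous_subspaceT => t.
apply: cvgD; first exact: cvg_cst.
apply: cvgZr_tmp; exact: real_complex_continuous.
Qed.

Theorem proposition5 (R : realType) (n : nat) (A : 'M[R[i]]_n)
    (lambda : R -> R[i]^o) :
  continuous_eigenvalue_function (gersgorin_homotopy A) lambda ->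
  exists D : set R[i]^o,
    [/\ gersgorin_region A D, connected D & lambda @` `[0, 1]%classic `<=` D].
Proof.
case=> lambda_cont lambda_eig.
set curve := lambda @` `[0, 1]%classic.
pose S := [set k : 'I_n | gersgorin_disk A k `&` curve !=set0].
have curveD : curve `<=` \bigcup_(k in S) gersgorin_disk A k.
  move=> _ [t t01 <-].
  have t01' : 0 <= t <= 1 by move: t01; rewrite /= in_itv.
  have [k Hk] := eigenvalue_in_gersgorin_disk (lambda_eig t t01').
  have Dk := gersgorin_disk_homotopy_sub t01' Hk.
  by exists k => //; exists (lambda t); split=> //; exists t.
exists (\bigcup_(k in S) gersgorin_disk A k); split=> //; first by exists S.
(* Adding the curve to each disk does not change D and gives the pieces a
   common point. *)
have -> : \bigcup_(k in S) gersgorin_disk A k =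
    \bigcup_(k in S) (gersgorin_disk A k `|` curve).
  apply/seteqP; split=> [z [k Sk Dz]|z [k Sk [Dz|/curveD//]]].
    by exists k => //; left.
  by exists k.
apply: bigcup_connected.
  exists (lambda 0) => k _; right; exists 0 => //.
  by rewrite /= in_itv /= lexx ler01.
move=> k Sk; apply: connectedU => //; first exact: gersgorin_disk_connected.
by apply: connected_continuous_connected => //; exact: segment_connected.
Qed.
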